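(* Let $G$ be a group, $A$ an algebra over a field, and $\Gamma\colon A=\bigoplus_{g\in G}A^{(g)}$ a $G$-grading on $A$. Then (1) $\Gamma$ is weakly equivalent to a grading by a finite group if and only if the universal group $G_\Gamma$ is residually finite with respect to $\operatorname{diff}\varkappa_\Gamma(\operatorname{supp}\Gamma)$; (2) $\Gamma$ and all its coarsenings are each weakly equivalent to a grading by a finite group if and only if $G_\Gamma$ is hereditarily residually finite with respect to $\operatorname{diff}\varkappa_\Gamma(\operatorname{supp}\Gamma)$.
   Context: $\operatorname{supp}\Gamma=\lbrace g\in G\mid A^{(g)}\neq0\rbrace$. Two gradings $\Gamma_1\colon A=\bigoplus_{s\in S}A^{(s)}$ and $\Gamma_2\colon B=\bigoplus_{t\in T}B^{(t)}$ are weakly equivalent if there is an algebra isomorphism $\varphi\colon A\to B$ such that for every $s$ with $A^{(s)}\neq0$ there is $t$ with $\varphi(A^{(s)})=B^{(t)}$. A realization of $\Gamma$ as a grading by a group $H$ is an $H$-grading of $A$ with the same nonzero components, recorded by the injection $\psi\colon\operatorname{supp}\Gamma\to H$ of degrees. The universal group $(G_\Gamma,\varkappa_\Gamma)$ of $\Gamma$ is a group realizing $\Gamma$ with support embedding $\varkappa_\Gamma\colon\operatorname{supp}\Gamma\hookrightarrow G_\Gamma$ such that for any realization $\psi\colon\operatorname{supp}\Gamma\hookrightarrow H$ there is a unique homomorphism $\varphi\colon G_\Gamma\to H$ with $\varphi\varkappa_\Gamma=\psi$. Concretely, $G_\Gamma$ is generated by symbols $[g]$, $g\in\operatorname{supp}\Gamma$,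 with relations $[g][h]=[gh]$ for $g,h\in\operatorname{supp}\Gamma$ with $A^{(g)}A^{(h)}\neq0$, and $\varkappa_\Gamma(g)$ is the image of $[g]$. A coarsening of $\Gamma$ is a grading $A=\bigoplus_{h\in H}A^{(h)}$ of the same algebra by a group $H$ such that for every $g\in G$ with $A^{(g)}\neq0$ there is $h\in H$ with $A^{(g)}\subseteq A^{(h)}$. For a subset $U$ of a group, $\operatorname{diff}U=\lbrace uv^{-1}\mid u,v\in U,\ u\neq v\rbrace$. A group $K$ is residually finite with respect to a subset $W\subseteq K$ if there is a normal subgroup $N\triangleleft K$ of finite index with $W\cap N=\varnothing$. $K$ is hereditarily residually finite with respect to $W$ if for the normal closure $N_1\triangleleft K$ of any subset of $W$ there is a normal subgroup $N\triangleleft K$ of finite index with $N_1\subseteq N$ and $W\cap N=W\cap N_1$. *)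

(* Defs.v *)
From HB Require Import structures.
From mathcomp Require Import all_boot all_order all_algebra all_fingroup.
From mathcomp Require Import boolp classical_sets functions cardinality.

Set Implicit Arguments.
Unset Strict Implicit.
Unset Printing Implicit Defensive.

Import GRing.Theory.
Local Open Scope classical_set_scope.
Local Open Scope ring_scope.

(* A vector space with a bilinear product; neither associativity nor a unit is
   assumed (the library's algType has both). *)
Record algebra (F : fieldType) := NAlgebra {
  algebra_sort :> lmodType F;
  algebra_mul : {bilinear algebra_sort -> algebra_sort -> algebra_sort}
}.

Notation "a ** b" := (algebra_mul _ a b)
  (at level 40, left associativity) : ring_scope.

Definition algebra_iso (F : fieldType) (A B : algebra F)
    (phi : {linear A -> B}) : Prop :=
  bijective phi /\ forall a b : A, phi (a ** b) = phi a ** phi b.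

Record grading (F : fieldType) (A : algebra F) (G : groupType) := Grading {
  component :> G -> set A;
  component_submod : forall g, submod_closed [in component g];
  component_span : forall a : A, exists s : seq G, exists f : G -> A,
    [/\ uniq s, forall g, component g (f g) & a = \sum_(g <- s) f g];
  component_free : forall (s : seq G) (f : G -> A), uniq s ->
    (forall g, component g (f g)) -> \sum_(g <- s) f g = 0 ->
    forall g, g \in s -> f g = 0;
  component_mul : forall g h (a b : A), component g a -> component h b ->
    component (g * h)%g (a ** b)
}.

Definition supp (F : fieldType) (A : algebra F) (G : groupType)
    (Gam : grading A G) : set G := [set g | Gam g <> [set 0]].

Definition weakly_equivalent (F : fieldType) (A B : algebra F)
    (S T : groupType) (Gam1 : grading A S) (Gam2 : grading B T) : Prop :=
  exists2 phi : {linear A -> B}, algebra_iso phi &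
    forall s, supp Gam1 s -> exists t, phi @` Gam1 s = Gam2 t.

Definition finite_group_weakly_equivalent (F : fieldType) (A : algebra F)
    (G : groupType) (Gam : grading A G) : Prop :=
  exists (B : algebra F) (H : finGroupType) (Del : grading B H),
    weakly_equivalent Gam Del.

Definition coarsening (F : fieldType) (A : algebra F) (G H : groupType)
    (Gam : grading A G) (Del : grading A H) : Prop :=
  forall g, supp Gam g -> exists h, Gam g `<=` Del h.

(* The support is used as a type here: classical_sets coerces a set to the
   subtype of its elements, with projection val. *)
Definition is_realization (F : fieldType) (A : algebra F) (G H : groupType)
    (Gam : grading A G) (Del : grading A H) (psi : supp Gam -> H) : Prop :=
  [/\ injective psi, forall g : supp Gam, Del (psi g) = Gam (val g)
    & supp Del = range psi].

Definition realizes (F : fieldType) (A : algebra F) (G H : groupType)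
    (Gam : grading A G) (psi : supp Gam -> H) : Prop :=
  exists Del : grading A H, is_realization Del psi.

Definition is_universal_group (F : fieldType) (A : algebra F) (G : groupType)
    (Gam : grading A G) (U : groupType) (kappa : supp Gam -> U) : Prop :=
  realizes kappa /\
  forall (H : groupType) (psi : supp Gam -> H), realizes psi ->
    exists! phi : U -> H, {morph phi : x y / (x * y)%g} /\ phi \o kappa = psi.

Definition diff (K : groupType) (U : set K) : set K :=
  [set x | exists u v, [/\ U u, U v, u <> v & x = (u * v^-1)%g]].

Definition normal_subgroup (K : groupType) (N : set K) : Prop :=
  group_closed [in N] /\ forall x y, N x -> N (x ^ y)%g.

Definition finite_index (K : groupType) (N : set K) : Prop :=
  finite_set (range (fun x : K => [set (x * n)%g | n in N])).

Definition normal_closure (K : groupType) (X : set K) : set K :=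
  [set x | forall N, normal_subgroup N -> X `<=` N -> N x].

Definition residually_finite_wrt (K : groupType) (W : set K) : Prop :=
  exists N : set K, [/\ normal_subgroup N, finite_index N & W `&` N = set0].

Definition hereditarily_residually_finite_wrt (K : groupType) (W : set K) :
    Prop :=
  forall X : set K, X `<=` W -> let N1 := normal_closure X in
  exists N : set K, [/\ normal_subgroup N, finite_index N, N1 `<=` N
    & W `&` N = W `&` N1].

(* Existence of the universal group: the group presented by the generators [g]
   for g in the support, with relations [g][h] = [gh] whenever the product of
   the components of degrees g and h is nonzero. A letter (b, g) stands for [g]
   if b holds and for its inverse otherwise. *)

Definition nonzero_product (F : fieldType) (A : algebra F) (G : groupType)
    (Gam : grading A G) (g h : G) : Prop :=
  exists a b : A, [/\ Gam g a, Gam h b & a ** b <> 0].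

Definition word (F : fieldType) (A : algebra F) (G : groupType)
    (Gam : grading A G) := seq (bool * supp Gam).

Inductive word_cong (F : fieldType) (A : algebra F) (G : groupType)
    (Gam : grading A G) : word Gam -> word Gam -> Prop :=
| WcRefl w : word_cong w w
| WcSym w1 w2 : word_cong w1 w2 -> word_cong w2 w1
| WcTrans w2 w1 w3 : word_cong w1 w2 -> word_cong w2 w3 -> word_cong w1 w3
| WcCat w1 w1' w2 w2' : word_cong w1 w1' -> word_cong w2 w2' ->
    word_cong (w1 ++ w2) (w1' ++ w2')
| WcInv b g : word_cong [:: (b, g); (~~ b, g)] [::]
| WcRel (g h k : supp Gam) : nonzero_product Gam (val g) (val h) ->
    val k = (val g * val h)%g ->
    word_cong [:: (true, g); (true, h)] [:: (true, k)].

Section Presentation.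
Variables (F : fieldType) (A : algebra F) (G : groupType) (Gam : grading A G).

Definition word_rel : rel (word Gam) := fun w1 w2 => `[< word_cong w1 w2 >].

Fact word_rel_equiv : equiv_class_of word_rel.
Proof.
split=> [w|w1 w2|w2 w1 w3].
- by apply/asboolP; exact: WcRefl.
- by apply/asboolP/asboolP; exact: WcSym.
- by move=> /asboolP w12 /asboolP w23; apply/asboolP; exact: WcTrans w12 w23.
Qed.

Canonical word_equiv : equiv_rel (word Gam) := EquivRelPack word_rel_equiv.

Definition universal_group := {eq_quot word_equiv}%qT.

HB.instance Definition _ := Choice.on universal_group.

Local Notation pi := (\pi_universal_group)%qT.
Local Notation repr := generic_quotient.repr.

Lemma pi_eq (w1 w2 : word Gam) : word_cong w1 w2 <-> pi w1 = pi w2.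
Proof.
by split=> [w12|/eqmodP/asboolP//]; apply/eqmodP/asboolP.
Qed.

Lemma repr_cong (w : word Gam) : word_cong (repr (pi w)) w.
Proof. by apply/pi_eq; rewrite reprK. Qed.

Lemma univP (x : universal_group) : exists w, x = pi w.
Proof. by exists (repr x); rewrite reprK. Qed.

Definition word_inv (w : word Gam) : word Gam :=
  rev [seq (~~ p.1, p.2) | p <- w].

Lemma word_inv_cat w1 w2 : word_inv (w1 ++ w2) = word_inv w2 ++ word_inv w1.
Proof. by rewrite /word_inv map_cat rev_cat. Qed.

Lemma word_invK : involutive word_inv.
Proof.
move=> w; rewrite /word_inv map_rev revK -map_comp map_id_in// => -[b g] _ /=.
by rewrite negbK.
Qed.

Lemma word_invr w : word_cong (w ++ word_inv w) [::].
Proof.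
elim: w => [|[b g] w IHw]; first exact: WcRefl.
have -> : ((b, g) :: w) ++ word_inv ((b, g) :: w) =
    [:: (b, g)] ++ ((w ++ word_inv w) ++ [:: (~~ b, g)]).
  by rewrite /word_inv /= rev_cons -cats1 !catA.
apply: WcTrans (WcInv b g); rewrite -[X in word_cong _ X]/([:: (b, g)] ++
  ([::] ++ [:: (~~ b, g)])).
by apply: WcCat; [exact: WcRefl|apply: WcCat => //; exact: WcRefl].
Qed.

Lemma word_invl w : word_cong (word_inv w ++ w) [::].
Proof. by rewrite -{2}[w]word_invK; exact: word_invr. Qed.

Lemma word_inv_cong w1 w2 :
  word_cong w1 w2 -> word_cong (word_inv w1) (word_inv w2).
Proof.
move=> w12; apply: (WcTrans (w2 := word_inv w1 ++ (w2 ++ word_inv w2))).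
  rewrite -[X in word_cong X _]cats0; apply: WcCat; first exact: WcRefl.
  exact/WcSym/word_invr.
rewrite catA -[X in word_cong _ X]cat0s; apply: WcCat; last exact: WcRefl.
apply: WcTrans (word_invl w1); apply: WcCat; first exact: WcRefl.
exact: WcSym.
Qed.

Definition univ_one : universal_group := pi [::].
Definition univ_inv (x : universal_group) : universal_group :=
  pi (word_inv (repr x)).
Definition univ_mul (x y : universal_group) : universal_group :=
  pi (repr x ++ repr y).

Lemma univ_mulE w1 w2 : univ_mul (pi w1) (pi w2) = pi (w1 ++ w2).
Proof. by apply/pi_eq/WcCat; exact: repr_cong. Qed.

Lemma univ_invE w : univ_inv (pi w) = pi (word_inv w).
Proof. exact/pi_eq/word_inv_cong/repr_cong. Qed.

Fact univ_mulA : associative univ_mul.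
Proof.
move=> u v w; have [u' ->] := univP u.
have [v' ->] := univP v; have [w' ->] := univP w.
by rewrite !univ_mulE catA.
Qed.
Fact univ_mul1g : left_id univ_one univ_mul.
Proof. by move=> x; have [w' ->] := univP x; rewrite univ_mulE. Qed.
Fact univ_mulg1 : right_id univ_one univ_mul.
Proof. by move=> x; have [w' ->] := univP x; rewrite univ_mulE cats0. Qed.
Fact univ_mulVg : left_inverse univ_one univ_inv univ_mul.
Proof.
by move=> x; have [w' ->] := univP x;
rewrite univ_invE univ_mulE; exact/pi_eq/word_invl.
Qed.
Fact univ_mulgV : right_inverse univ_one univ_inv univ_mul.
Proof.
by move=> x; have [w' ->] := univP x;
rewrite univ_invE univ_mulE; exact/pi_eq/word_invr.
Qed.

HB.instance Definition _ := isGroup.Build universal_group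
  univ_mulA univ_mul1g univ_mulg1 univ_mulVg univ_mulgV.

Definition universal_embedding (g : supp Gam) : universal_group :=
  pi [:: (true, g)].

End Presentation.

Section Pushforward.
Variables (F : fieldType) (A : algebra F) (G H : groupType) (Gam : grading A G).

Lemma component0 g : Gam g 0.
Proof. by have [/[!inE]] := component_submod Gam g. Qed.

Lemma component_eq0 g a : ~ supp Gam g -> Gam g a -> a = 0.
Proof. by move=> /contrapT -> . Qed.

Lemma mem_supp g a : Gam g a -> a <> 0 -> supp Gam g.
Proof. by move=> ga a0 g0; apply: a0; move: ga; rewrite g0. Qed.

Lemma supp_ex g : supp Gam g -> exists2 a, Gam g a & a <> 0.
Proof.
move=> gS; apply: contrapT => noa; apply: gS; apply/seteqP; split=> a /=.
  by move=> ga; apply: contrapT => a0; apply: noa; exists a.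
by move=> ->; exact: component0.
Qed.

Lemma component_inj g h a : Gam g a -> Gam h a -> a <> 0 -> g = h.
Proof.
move=> ga ha a0; apply/eqP/negPn/negP => gh; apply: a0.
pose f k := if k == g then a else if k == h then - a else 0.
have fE k : Gam k (f k).
  rewrite /f; case: eqP => [->//|_]; case: eqP => [->|_]; last exact: component0.
  have [/[!inE] h0 /(_ (-1) a 0)] := component_submod Gam h.
  by rewrite !inE scaleN1r addr0; exact.
have := @component_free _ _ _ Gam [:: g; h] f _ fE _ g.
rewrite /f eqxx mem_head; apply=> //; first by rewrite /= inE gh.
by rewrite !big_cons big_nil eqxx eq_sym (negPf gh) eqxx addr0 subrr.
Qed.

Variable psi : supp Gam -> H.
Hypothesis psi_inj : injective psi.
Hypothesis psiM : forall g h k : supp Gam,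
  nonzero_product Gam (val g) (val h) -> val k = (val g * val h)%g ->
  psi k = (psi g * psi h)%g.

Definition psi_inv (h : H) : option (supp Gam) :=
  if pselect (exists g, psi g = h) is left e then Some (sval (cid e)) else None.

Lemma psiK : pcancel psi psi_inv.
Proof.
move=> g; rewrite /psi_inv; case: pselect => [e|[]]; last by exists g.
by case: cid => g' /= /psi_inj ->.
Qed.

Lemma psi_invK : ocancel psi_inv psi.
Proof. by move=> h; rewrite /psi_inv; case: pselect => // e; case: cid. Qed.

Definition push_component (h : H) : set A :=
  if psi_inv h is Some g then Gam (val g) else [set 0].

Fact push_submod h : submod_closed [in push_component h].
Proof.
rewrite /push_component; case: (psi_inv h) => [g|].
  exact: component_submod.
split=> [|c u v /set_mem -> /set_mem ->]; first exact/mem_set.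
by rewrite scaler0 addr0; exact/mem_set.
Qed.

Fact push_span (a : A) : exists s : seq H, exists f : H -> A,
  [/\ uniq s, forall h, push_component h (f h) & a = \sum_(h <- s) f h].
Proof.
have [s [f [us fE ->]]] := component_span Gam a.
exists [seq psi g | g <- pmap insub s].
exists (fun h => if psi_inv h is Some g then f (val g) else 0); split.
- by rewrite (map_inj_uniq psi_inj) pmap_sub_uniq.
- by move=> h; rewrite /push_component; case: psi_inv.
rewrite big_map.
under eq_bigr do rewrite psiK.
elim: s {us} => [|g s IHs]; first by rewrite !big_nil.
rewrite big_cons IHs /=; case: insubP => [u _ uE|gS] /=.
  by rewrite big_cons -uE.
rewrite (@component_eq0 g (f g)) ?add0r //.
by move=> gS'; move/negP: gS; apply; exact/mem_set.
Qed.

Fact push_free (s : seq H) (f : H -> A) : uniq s ->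
  (forall h, push_component h (f h)) -> \sum_(h <- s) f h = 0 ->
  forall h, h \in s -> f h = 0.
Proof.
move=> us fE s0 h hs; have := fE h; rewrite /push_component.
case hg: (psi_inv h) => [g|]//.
have psig : psi g = h by have := psi_invK h; rewrite hg.
move=> _; pose f' g := if insub g is Some x then f (psi x) else 0.
have f'E (x : supp Gam) : f' (val x) = f (psi x) by rewrite /f' valK.
rewrite -psig -f'E.
apply: (@component_free _ _ _ Gam (map val (pmap psi_inv s)) f').
- by rewrite (map_inj_uniq val_inj) (pmap_uniq psi_invK).
- move=> k; rewrite /f'; case: insubP => [x _ <-|_]; last exact: component0.
  by have := fE (psi x); rewrite /push_component psiK.
- rewrite -[RHS]s0 big_map; under eq_bigr do rewrite f'E.
  elim: s {us s0 hs} => [|k s IHs]; first by rewrite !big_nil.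
  rewrite /= big_cons -IHs; have := psi_invK k; have := fE k.
  rewrite /push_component; case: psi_inv => [x _ /= <-|/= -> _].
    by rewrite big_cons.
  by rewrite add0r.
- by apply: map_f; rewrite mem_pmap -hg; exact: map_f.
Qed.

Fact push_mul h k (a b : A) : push_component h a -> push_component k b ->
  push_component (h * k)%g (a ** b).
Proof.
have push0 l : push_component l 0.
  by rewrite /push_component; case: psi_inv => [g|//]; exact: component0.
have := psi_invK h; have := psi_invK k.
rewrite {1 2}/push_component.
case: (psi_inv k) => [y|]; last by move=> _ _ _ ->; rewrite linear0r.
case: (psi_inv h) => [x|]; last by move=> _ _ ->; rewrite linear0l.
move=> /= <- <- xa yb; have [->//|/eqP ab0] := eqVneq (a ** b) 0.
have xyab := component_mul xa yb; have /mem_set xyS := mem_supp xyab ab0.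
rewrite -(@psiM x y (SigSub xyS))//; last by exists a, b.
by rewrite /push_component psiK.
Qed.

Definition pushforward : grading A H :=
  Grading push_submod push_span push_free push_mul.

Lemma pushforward_realization : is_realization pushforward psi.
Proof.
split=> [//|g|]; first by rewrite /= /push_component psiK.
apply/seteqP; split=> h; rewrite /supp /= /push_component.
  by have := psi_invK h; case: psi_inv => //= g gh _; exists g.
by move=> [g _ <-]; rewrite psiK; exact: (set_mem (valP g)).
Qed.

End Pushforward.

Section Universality.
Variables (F : fieldType) (A : algebra F) (G : groupType) (Gam : grading A G).

Lemma realizesM (H : groupType) (psi : supp Gam -> H) : realizes psi ->
  forall g h k : supp Gam, nonzero_product Gam (val g) (val h) ->
  val k = (val g * val h)%g -> psi k = (psi g * psi h)%g.
Proof.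
move=> [Del [_ DelE _]] g h k [a [b [ga hb ab0]]] kE.
apply: (@component_inj _ _ _ Del _ _ (a ** b)) => //.
  by rewrite DelE kE; exact: component_mul.
by apply: component_mul; rewrite DelE.
Qed.

Section Eval.
Variables (H : groupType) (psi : supp Gam -> H).
Hypothesis psiM : forall g h k : supp Gam,
  nonzero_product Gam (val g) (val h) -> val k = (val g * val h)%g ->
  psi k = (psi g * psi h)%g.

Definition word_eval (w : word Gam) : H :=
  foldr (fun p x => ((if p.1 then psi p.2 else (psi p.2)^-1) * x)%g) 1%g w.

Lemma word_eval_cat w1 w2 :
  word_eval (w1 ++ w2) = (word_eval w1 * word_eval w2)%g.
Proof. by elim: w1 => [|p w IHw]; rewrite /= ?mul1g// IHw mulgA. Qed.

Lemma word_eval_cong w1 w2 : word_cong w1 w2 -> word_eval w1 = word_eval w2.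
Proof.
elim=> {w1 w2} //= [w2 w1 w3 _ -> //|w1 w1' w2 w2' _ IH1 _ IH2|[] g|g h k gh kE].
- by rewrite !word_eval_cat IH1 IH2.
- by rewrite mulg1 mulgV.
- by rewrite mulg1 mulVg.
- by rewrite !mulg1 (psiM gh kE).
Qed.

Definition univ_eval (x : universal_group Gam) : H :=
  word_eval (generic_quotient.repr x).

Lemma univ_evalE w : univ_eval (\pi_(universal_group Gam) w)%qT = word_eval w.
Proof. exact/word_eval_cong/repr_cong. Qed.

Lemma univ_evalM : {morph univ_eval : x y / (x * y)%g}.
Proof.
move=> x y; have [u' ->] := univP x; have [v' ->] := univP y.
by rewrite [(_ * _)%g]univ_mulE !univ_evalE word_eval_cat.
Qed.

Lemma univ_eval_embedding : univ_eval \o @universal_embedding _ _ _ Gam = psi.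
Proof. by apply/funext => g; rewrite /= univ_evalE /= mulg1. Qed.

Lemma univ_eval_unique (phi : universal_group Gam -> H) :
  {morph phi : x y / (x * y)%g} ->
  phi \o @universal_embedding _ _ _ Gam = psi -> phi = univ_eval.
Proof.
move=> phiM phiE; apply/funext => x; have [w ->] := univP x; rewrite univ_evalE.
have phi1 : phi 1%g = 1%g by apply: (mulgI (phi 1%g)); rewrite -phiM !mulg1.
elim: w => [|[b g] w IHw]; first exact: phi1.
rewrite -cat1s -univ_mulE [phi _]phiM IHw word_eval_cat; congr (_ * _)%g.
have phig : phi (universal_embedding g) = psi g by rewrite -phiE.
rewrite /= mulg1; case: b => //; rewrite -phig; apply: (mulgI (phi (universal_embedding g))).
rewrite mulgV -phiM -phi1; congr phi; rewrite [LHS]univ_mulE.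
exact/pi_eq/(WcInv true).
Qed.

End Eval.

Theorem universal_groupP : is_universal_group (@universal_embedding _ _ _ Gam).
Proof.
split; last first.
  move=> H psi /realizesM psiM; exists (univ_eval psi); split.
    by split; [exact: univ_evalM|exact: univ_eval_embedding].
  by move=> phi [phiM phiE]; rewrite -(univ_eval_unique psiM phiM phiE).
have inj : injective (@universal_embedding _ _ _ Gam).
  have valM (g h k : supp Gam) : nonzero_product Gam (val g) (val h) ->
    val k = (val g * val h)%g -> val k = (val g * val h)%g by [].
  have evalE g : univ_eval val (universal_embedding g) = val g.
    exact: (congr1 (@^~ g) (univ_eval_embedding valM)).
  by move=> g h /(congr1 (univ_eval val)); rewrite !evalE => /val_inj.
have embM (g h k : supp Gam) : nonzero_product Gam (val g) (val h) ->
    val k = (val g * val h)%g -> universal_embedding k =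
    (universal_embedding g * universal_embedding h)%g.
  move=> gh kE; rewrite [RHS]univ_mulE; exact/esym/pi_eq/(WcRel gh kE).
exists (pushforward inj embM); exact: pushforward_realization.
Qed.

End Universality.

(* Main.v *)
Require Import Defs.
From HB Require Import structures.
From mathcomp Require Import all_boot all_order all_algebra all_fingroup.
From mathcomp Require Import boolp classical_sets functions cardinality.

(** Let W be the set of quotients of distinct degrees in the universal group U,
and kappa the embedding of the support in U.

A coarsening Del of Gam gives every g in the support a degree d g in the group
of Del. The map d is multiplicative wherever the product of components is
nonzero, so it extends to a homomorphism f from U ([universal_lift]). Although
d need not be injective, and so is not covered by the universal property itself,
U maps to the presented group, on whose generators d can be prescribed. In this
way a coarsening is an f, and two degrees of Gam are merged in it exactly when
their quotient lies in the kernel of f. For homomorphisms f and f' out of U,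
the equality of W meet ker f and W meet ker f' therefore says that f and f'
merge the same degrees ([diff_kernelP]).

A grading is weakly equivalent to one by a finite group exactly when its
support can be relabelled, injectively and multiplicatively, by elements of a
finite group ([finite_group_weakly_equivalentP]). For the coarsening given by
f, such a relabelling amounts to a homomorphism f' from U to a finite group
that merges the same degrees as f, hence to a normal subgroup N = ker f' of
finite index with W meet N = W meet ker f ([coarsening_finiteP]).

Everything follows from this criterion. Gam itself is the coarsening whose f
merges nothing, so that W meet ker f is empty: this is the first equivalence.
For the second one, if all coarsenings are finite up to weak equivalence, a
subset X of W with normal closure N1 is handled by the coarsening induced by
the projection from U to U / N1 ([induced_coarsening]); the subgroup N that the
criterion provides contains X, hence N1. Conversely, for a coarsening given by
f, hereditary residual finiteness is applied to X = W meet ker f: the normal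
closure of X lies between X and ker f, so it meets W exactly in X. *)

Local Open Scope classical_set_scope.

Set Implicit Arguments.
Unset Strict Implicit.
Unset Printing Implicit Defensive.

Import GRing.Theory.

(** * Group homomorphisms and normal subgroups *)

Definition kernel (K H : groupType) (f : K -> H) : set K := [set x | f x = 1%g].

Section Morphism.
Variables (K H : groupType) (f : K -> H).
Hypothesis fM : {morph f : x y / (x * y)%g}.

Lemma group_morph1 : f 1%g = 1%g.
Proof. by apply: (mulgI (f 1%g)); rewrite -fM !mulg1. Qed.

Lemma group_morphV x : f x^-1%g = (f x)^-1%g.
Proof. by apply: (mulgI (f x)); rewrite -fM !mulgV group_morph1. Qed.

Lemma kernel_div x y : kernel f (x * y^-1)%g <-> f x = f y.
Proof.
rewrite /kernel /= fM group_morphV; split=> [/(congr1 (mulg^~ (f y)))|->].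
  by rewrite mulgVK mul1g.
by rewrite mulgV.
Qed.

Lemma kernel_normal : normal_subgroup (kernel f).
Proof.
split=> [|x y]; first split=> [|x y]; rewrite ?inE /kernel /=.
- exact: group_morph1.
- by move=> xf yf; rewrite fM group_morphV xf yf mulgV.
- by move=> xf; rewrite conjgE !fM group_morphV xf mul1g mulVg.
Qed.

End Morphism.

(** The cosets of the kernel are the nonempty fibres of the map. *)
Lemma kernel_finite_index (K : groupType) (H : finGroupType) (f : K -> H) :
  {morph f : x y / (x * y)%g} -> finite_index (kernel f).
Proof.
move=> fM.
apply: (@sub_finite_set _ _ (range (fun h : H => [set x | f x = h]))).
  2: exact/finite_image/finite_finset.
move=> _ [x _ <-]; exists (f x) => //; apply/seteqP; split=> y /=.
  move=> xy; exists (x^-1 * y)%g; last by rewrite mulKVg.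
  by rewrite /kernel /= fM (group_morphV fM) xy mulVg.
by move=> [n n1 <-]; rewrite fM n1 mulg1.
Qed.

Section Quotient.
Variables (K : groupType) (N : set K).
Hypothesis normalN : normal_subgroup N.

Lemma normal_subgroup1 : N 1%g.
Proof. by have [[/[!inE]]] := normalN. Qed.

Lemma normal_subgroup_div x y : N x -> N y -> N (x * y^-1)%g.
Proof. by have [[_ /(_ x y)] /[!inE]] := normalN. Qed.

Lemma normal_subgroupV x : N x -> N x^-1%g.
Proof.
move=> Nx; rewrite -[x^-1%g]mul1g.
exact: normal_subgroup_div normal_subgroup1 Nx.
Qed.

Lemma normal_subgroupM x y : N x -> N y -> N (x * y)%g.
Proof.
move=> Nx /normal_subgroupV Ny; rewrite -[y]invgK.
exact: normal_subgroup_div.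
Qed.

Lemma normal_subgroupJ x y : N x -> N (y * x * y^-1)%g.
Proof.
by have [_ /[apply] /(_ y^-1%g)] := normalN; rewrite conjgE invgK mulgA.
Qed.

Definition same_coset : rel K := fun x y => `[< N (x * y^-1)%g >].

Fact same_coset_equiv : equiv_class_of same_coset.
Proof.
have sym x y : same_coset x y -> same_coset y x.
  by move=> /asboolP/normal_subgroupV; rewrite invgM invgK => ?; exact/asboolP.
split=> [x|x y|y x z].
- by apply/asboolP; rewrite mulgV; exact: normal_subgroup1.
- by apply/idP/idP; exact: sym.
- move=> /asboolP xy /asboolP yz; apply/asboolP.
  by rewrite -(mulgKV y x) -mulgA; exact: normal_subgroupM.
Qed.

Canonical same_coset_rel := EquivRelPack same_coset_equiv.

Definition normal_quotient := {eq_quot same_coset_rel}%qT.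

HB.instance Definition _ := Choice.on normal_quotient.

Definition quotient_proj (x : K) : normal_quotient :=
  (\pi_normal_quotient x)%qT.

Lemma quotient_proj_eq x y :
  quotient_proj x = quotient_proj y <-> N (x * y^-1)%g.
Proof. by split=> [/eqmodP/asboolP|xy]//; apply/eqmodP/asboolP. Qed.

Lemma quotient_proj_surj q : exists x, quotient_proj x = q.
Proof. by exists (generic_quotient.repr q); exact: generic_quotient.reprK. Qed.

Definition quotient_mul (p q : normal_quotient) : normal_quotient :=
  quotient_proj (generic_quotient.repr p * generic_quotient.repr q)%g.
Definition quotient_inv (p : normal_quotient) : normal_quotient :=
  quotient_proj (generic_quotient.repr p)^-1%g.

Lemma repr_coset x : N (generic_quotient.repr (quotient_proj x) * x^-1)%g.
Proof. by apply/quotient_proj_eq; exact: generic_quotient.reprK. Qed.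

Lemma quotient_mulE x y :
  quotient_mul (quotient_proj x) (quotient_proj y) = quotient_proj (x * y)%g.
Proof.
apply/quotient_proj_eq; set x' := generic_quotient.repr _.
have /(normal_subgroupJ x') := repr_coset y.
set y' := generic_quotient.repr _ => /normal_subgroupM/(_ (repr_coset x)).
by rewrite -/x' invgM !mulgA mulgVK.
Qed.

Lemma quotient_invE x : quotient_inv (quotient_proj x) = quotient_proj x^-1%g.
Proof.
apply/quotient_proj_eq; set x' := generic_quotient.repr _.
have /normal_subgroupV/(normal_subgroupJ x^-1%g) := repr_coset x.
rewrite -/x' !invgM !invgK !mulgA mulVg mul1g => /(normal_subgroupJ x).
have /normal_subgroupV/(normal_subgroupJ x'^-1%g) := repr_coset x.
by rewrite -/x' !invgM !invgK !mulgA mulgVK.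
Qed.

Fact quotient_mulA : associative quotient_mul.
Proof.
move=> p q r; have [x <-] := quotient_proj_surj p.
have [y <-] := quotient_proj_surj q; have [z <-] := quotient_proj_surj r.
by rewrite !quotient_mulE mulgA.
Qed.

Fact quotient_mul1 : left_id (quotient_proj 1%g) quotient_mul.
Proof.
by move=> p; have [x <-] := quotient_proj_surj p; rewrite quotient_mulE mul1g.
Qed.

Fact quotient_mulr1 : right_id (quotient_proj 1%g) quotient_mul.
Proof.
by move=> p; have [x <-] := quotient_proj_surj p; rewrite quotient_mulE mulg1.
Qed.

Fact quotient_mulV : left_inverse (quotient_proj 1%g) quotient_inv quotient_mul.
Proof.
by move=> p; have [x <-] := quotient_proj_surj p;
rewrite quotient_invE quotient_mulE mulVg.
Qed.
Fact quotient_mulrV :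
  right_inverse (quotient_proj 1%g) quotient_inv quotient_mul.
Proof.
by move=> p; have [x <-] := quotient_proj_surj p;
rewrite quotient_invE quotient_mulE mulgV.
Qed.

HB.instance Definition _ := isGroup.Build normal_quotient
  quotient_mulA quotient_mul1 quotient_mulr1 quotient_mulV quotient_mulrV.

Lemma quotient_projM : {morph quotient_proj : x y / (x * y)%g}.
Proof. by move=> x y; rewrite -quotient_mulE. Qed.

Lemma kernel_quotient_proj : kernel quotient_proj = N.
Proof.
apply/seteqP; split=> x; rewrite -{1}[x in N x]mulg1 -invg1.
  by move/quotient_proj_eq.
by move=> Nx; apply/quotient_proj_eq.
Qed.

(** A coset, as a set, determines its class: project any of its elements. *)
Lemma finite_quotient : finite_index N -> finite_set [set: normal_quotient].
Proof.
move=> finN; pose point (c : set K) := quotient_proj (xget 1%g c).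
apply: sub_finite_set (finite_image point finN) => q _.
have [x <-] := quotient_proj_surj q.
exists [set (x * n)%g | n in N]; first by exists x.
rewrite /point.
case: (xgetP 1%g [set (x * n)%g | n in N]) => [_ -> [n Nn <-]|/(_ x) []].
  by apply/quotient_proj_eq; exact: normal_subgroupJ.
by exists 1%g; [exact: normal_subgroup1|rewrite mulg1].
Qed.

End Quotient.

(** Choosing an enumeration turns classical finiteness into a [finGroupType]
structure on the same group, so that i is the identity. *)
Lemma finite_set_finGroup (Q : groupType) : finite_set [set: Q] ->
  exists (H : finGroupType) (i : Q -> H),
    {morph i : x y / (x * y)%g} /\ injective i.
Proof.
move=> finQ; pose e : seq Q := finmap.enum_fset (fset_set [set: Q]).
have mem_e x : x \in e by rewrite /e in_fset_set// inE.
have indexK : pcancel (index^~ e) (fun n => Some (nth 1%g e n)).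
  by move=> x; rewrite nth_index.
have enumP : Finite.axiom e.
  by move=> x; rewrite count_uniq_mem ?mem_e// finmap.fset_uniq.
pose Qcount := isCountable.Build Q indexK.
pose C : countType := HB.pack Q Qcount.
pose Qfin := isFinite.Build C enumP.
pose H : finGroupType := HB.pack Q Qcount Qfin.
by exists H, (id : Q -> H); split.
Qed.

Lemma finite_index_kernel (K : groupType) (N : set K) :
  normal_subgroup N -> finite_index N ->
  exists (H : finGroupType) (f : K -> H),
    {morph f : x y / (x * y)%g} /\ kernel f = N.
Proof.
move=> normalN /(finite_quotient normalN)/finite_set_finGroup[H [i [iM i_inj]]].
exists H, (i \o quotient_proj normalN); split=> [x y /=|].
  by rewrite quotient_projM iM.
rewrite -[RHS](kernel_quotient_proj normalN); apply/seteqP; split=> x.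
  by rewrite /kernel /= => ix1; apply: i_inj; rewrite (group_morph1 iM).
by rewrite /kernel /= => ->; rewrite (group_morph1 iM).
Qed.

(** * Degree maps and the universal group *)

Section Degrees.
Variables (F : fieldType) (A : algebra F) (G : groupType) (Gam : grading A G).

(** These are the maps that respect the relations presenting the universal
group. *)
Definition degree_morphism (H : groupType) (d : supp Gam -> H) : Prop :=
  forall g h k : supp Gam, nonzero_product Gam (val g) (val h) ->
  val k = (val g * val h)%g -> d k = (d g * d h)%g.

Lemma degree_morphism_comp (H K : groupType) (f : H -> K) (d : supp Gam -> H) :
  {morph f : x y / (x * y)%g} -> degree_morphism d -> degree_morphism (f \o d).
Proof. by move=> fM dM g h k gh kE /=; rewrite (dM g h k)// fM. Qed.

(** The universal property speaks of injective degree maps only. The map d is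
arbitrary here, so U is first sent to the presented group, where d needs only
to respect the defining relations. *)
Lemma universal_lift (U H : groupType) (kappa : supp Gam -> U)
    (d : supp Gam -> H) : is_universal_group kappa -> degree_morphism d ->
  exists f : U -> H,
    {morph f : x y / (x * y)%g} /\ forall g, f (kappa g) = d g.
Proof.
move=> [_ univ] dM; have [realK _] := universal_groupP Gam.
have [phi [[phiM phiE] _]] := univ _ _ realK.
exists (univ_eval d \o phi); split=> [x y /=|g /=].
  by rewrite phiM univ_evalM.
rewrite -[phi _]/((phi \o kappa) g) phiE.
exact: (congr1 (@^~ g) (univ_eval_embedding dM)).
Qed.

Lemma universal_degree (U : groupType) (kappa : supp Gam -> U) :
  is_universal_group kappa -> degree_morphism kappa.
Proof. by move=> [/realizesM]. Qed.

(** Pulling a grading of B back along an isomorphism relabels the support of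
Gam; conversely, a relabelling of the support regrades A itself, and the
identity of A is a weak equivalence. *)
Lemma finite_group_weakly_equivalentP : finite_group_weakly_equivalent Gam <->
  exists (H : finGroupType) (d : supp Gam -> H),
    injective d /\ degree_morphism d.
Proof.
split=> [[B [H [Del [phi [[phi' phiK phi'K] phiM] phiE]]]]|[H [d [d_inj dM]]]].
  have /choice[d dE] (g : supp Gam) : exists t, phi @` Gam (val g) = Del t.
    exact/phiE/set_mem/(valP g).
  have phi_neq0 a : a <> 0%R -> phi a <> 0%R.
    by move=> a0 pa0; apply: a0; rewrite -(phiK a) pa0 -(phiK 0%R) linear0.
  have inDel g a : Gam (val g) a -> Del (d g) (phi a) by rewrite -dE; exists a.
  exists H, d; split=> [g h gh|g h k [a [b [ga hb /phi_neq0 ab0]]] kE].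
    have [a ga a0] := supp_ex (set_mem (valP g)).
    apply/val_inj/(component_inj ga) => //.
    by have := inDel _ _ ga; rewrite gh -dE => -[b hb /(can_inj phiK) <-].
  apply: (component_inj _ _ ab0).
    by apply: inDel; rewrite kE; exact: component_mul.
  by rewrite phiM; apply: component_mul; exact: inDel.
exists A, H, (pushforward d_inj dM), idfun; first by split=> //; exists id.
move=> s /mem_set sS; exists (d (SigSub sS)).
have [_ -> _] := pushforward_realization d_inj dM.
by rewrite /= image_id.
Qed.

End Degrees.

(** * Homogeneous components *)

Section Projections.
Local Open Scope ring_scope.
Variables (F : fieldType) (A : algebra F) (G : groupType) (Gam : grading A G).

Lemma component_linear g c a b :
  Gam g a -> Gam g b -> Gam g (c *: a + b).
Proof.
by have [_ /(_ c a b)/[!inE]] := component_submod Gam g.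
Qed.

Lemma component_decomposition a : exists p : G -> A,
  (forall g, Gam g (p g)) /\
  exists s : seq G, [/\ uniq s, forall g, g \notin s -> p g = 0
    & a = \sum_(g <- s) p g].
Proof.
have [s [f [us fE ->]]] := component_span Gam a.
exists (fun g => if g \in s then f g else 0); split=> [g|].
  by case: ifP => // _; exact: component0.
exists s; split=> // [g /negPf ->//|].
by rewrite !big_seq; apply: eq_bigr => g ->.
Qed.

Definition projection (g : G) (a : A) : A :=
  sval (cid (component_decomposition a)) g.

Lemma projection_component g a : Gam g (projection g a).
Proof. by rewrite /projection; case: cid => p []. Qed.

Lemma projection_sum a : exists2 s : seq G, uniq s &
  (forall g, g \notin s -> projection g a = 0) /\
  a = \sum_(g <- s) projection g a.
Proof.
by rewrite /projection; case: cid => p [pG [s [us p0 aE]]]; exists s.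
Qed.

Lemma sum_widen (s t : seq G) (p : G -> A) : uniq s -> uniq t ->
  {subset s <= t} -> (forall g, g \notin s -> p g = 0) ->
  \sum_(g <- t) p g = \sum_(g <- s) p g.
Proof.
move=> us ut st p0; rewrite (bigID (mem s))/= [X in _ + X]big1 ?addr0//.
rewrite -big_filter; apply/perm_big/uniq_perm => //; first exact: filter_uniq.
by move=> g; rewrite mem_filter andb_idr//; exact: st.
Qed.

(** Independence of the components makes [projection] independent of the
decomposition chosen for a; the two index sequences are compared on their
union. *)
Lemma projection_unique (s : seq G) (p : G -> A) (a : A) : uniq s ->
  (forall g, g \notin s -> p g = 0) -> (forall g, Gam g (p g)) ->
  a = \sum_(g <- s) p g -> forall g, projection g a = p g.
Proof.
move=> us p0 pG aE g; have [s' us' [p'0 aE']] := projection_sum a.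
pose t := undup (s ++ s').
have ut : uniq t by exact: undup_uniq.
have aEt : a = \sum_(g <- t) p g.
  by rewrite (@sum_widen s)// => x; rewrite mem_undup mem_cat => ->.
have aEt' : a = \sum_(g <- t) projection g a.
  by rewrite (@sum_widen s')// => x; rewrite mem_undup mem_cat orbC => ->.
have [gt|] := boolP (g \in t); last first.
  by rewrite mem_undup mem_cat negb_or => /andP[/p0 -> /p'0 ->].
apply/eqP; rewrite eq_sym -subr_eq0; apply/eqP.
apply: (@component_free _ _ _ Gam t (fun g => p g - projection g a)) => // [h|].
  rewrite -scaleN1r addrC; apply: component_linear => //.
  exact: projection_component.
by rewrite sumrB -aEt -aEt' subrr.
Qed.

Lemma projection_linear g : linear (projection g).
Proof.
move=> c a b; have [s us [s0 aE]] := projection_sum a.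
have [t ut [t0 bE]] := projection_sum b.
pose r := undup (s ++ t).
apply: (@projection_unique r (fun g => c *: projection g a + projection g b)).
- exact: undup_uniq.
- move=> h; rewrite mem_undup mem_cat negb_or => /andP[/s0 -> /t0 ->].
  by rewrite scaler0 addr0.
- by move=> h; apply: component_linear; exact: projection_component.
rewrite big_split/= -scaler_sumr {1}aE {1}bE; congr (_ *: _ + _); apply/esym.
  apply: sum_widen; rewrite ?undup_uniq// => x.
  by rewrite mem_undup mem_cat => ->.
apply: sum_widen; rewrite ?undup_uniq// => x.
by rewrite mem_undup mem_cat orbC => ->.
Qed.

HB.instance Definition _ g :=
  GRing.isLinear.Build F A A _ (projection g) (projection_linear g).

Lemma projection_homogeneous g h a : Gam g a ->
  projection h a = if h == g then a else 0.
Proof.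
move=> ga.
apply: (@projection_unique [:: g] (fun h => if h == g then a else 0)).
- by [].
- by move=> k; rewrite inE => /negPf ->.
- by move=> k; case: eqP => [->//|_]; exact: component0.
- by rewrite big_seq1 eqxx.
Qed.

Lemma eq_linear_homogeneous (V : lmodType F) (f f' : {linear A -> V}) :
  (forall (g : supp Gam) a, Gam (val g) a -> f a = f' a) -> f =1 f'.
Proof.
move=> ff' a; have [s _ [_ ->]] := projection_sum a.
rewrite !linear_sum; apply: eq_bigr => g _.
have [->|/eqP pg0] := eqVneq (projection g a) 0; first by rewrite !linear0.
have gS := mem_supp (projection_component g a) pg0.
exact: (ff' (SigSub (mem_set gS))) (projection_component g a).
Qed.

Lemma projection_eq0 a :
  (forall g : supp Gam, projection (val g) a = 0) -> a = 0.
Proof.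
move=> a0; have [s _ [_ ->]] := projection_sum a; apply: big1 => g _.
apply: contrapT => pg0.
have gS := mem_supp (projection_component g a) pg0.
exact: pg0 (a0 (SigSub (mem_set gS))).
Qed.

Lemma projection_mul_neq0 a b : a ** b <> 0 -> exists g h : supp Gam,
  projection (val g) a ** projection (val h) b <> 0.
Proof.
move=> ab0; apply: contrapT => no; apply: ab0.
have [s _ [_ ->]] := projection_sum a; have [t _ [_ ->]] := projection_sum b.
rewrite linear_sumlz; apply: big1 => g _.
rewrite linear_sumr; apply: big1 => h _; apply: contrapT => gh0.
have pg0 : projection g a <> 0 by move=> g0; rewrite g0 linear0l in gh0.
have ph0 : projection h b <> 0 by move=> h0; rewrite h0 linear0r in gh0.
have gS := mem_supp (projection_component g a) pg0.
have hS := mem_supp (projection_component h b) ph0.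
by apply: no; exists (SigSub (mem_set gS)), (SigSub (mem_set hS)).
Qed.

End Projections.

(** * Coarsenings *)

Section Coarsening.
Local Open Scope ring_scope.
Variables (F : fieldType) (A : algebra F) (G H : groupType).
Variables (Gam : grading A G) (Del : grading A H) (d : supp Gam -> H).
Hypothesis dDel : forall g, Gam (val g) `<=` Del (d g).

Lemma coarsening_degree_morphism : degree_morphism d.
Proof.
move=> g h k [a [b [ga hb ab0]]] kE; apply: (component_inj _ _ ab0).
  by apply: dDel; rewrite kE; exact: component_mul.
by apply: component_mul; exact: dDel.
Qed.

Lemma coarsening_supp g : supp Del (d g).
Proof.
by have [a /dDel ga /(mem_supp ga)] := supp_ex (set_mem (valP g)).
Qed.

(** Extracting the component of degree g needs only the part of a that has
degree d g in the coarsening; on homogeneous a this is clear. It is the source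
of all that follows about the components of Del. *)
Lemma projection_coarsening (g : supp Gam) a :
  projection Gam (val g) (projection Del (d g) a) = projection Gam (val g) a.
Proof.
apply: (@eq_linear_homogeneous _ _ _ Gam _
  (projection Gam (val g) \o projection Del (d g)) (projection Gam (val g))).
move=> h {}a ha /=; rewrite (projection_homogeneous (d g) (dDel ha)).
case: eqP => // gh; rewrite linear0 (projection_homogeneous _ ha).
by case: eqP => // /val_inj gh'; rewrite gh' in gh.
Qed.

Lemma projection_coarse_component (g : supp Gam) h a :
  Del h a -> projection Gam (val g) a <> 0 -> d g = h.
Proof.
move=> ha; rewrite -projection_coarsening (projection_homogeneous _ ha).
by case: eqP => // _; rewrite linear0.
Qed.

Lemma coarsening_supp_ex h : supp Del h -> exists g, d g = h.
Proof.
move=> /supp_ex[a ha a0]; apply: contrapT => no.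
apply/a0/(@projection_eq0 _ _ _ Gam).
move=> g; apply: contrapT => /(projection_coarse_component ha) gh.
by apply: no; exists g.
Qed.

(** If all products of homogeneous parts of a and b vanished, so would a ** b;
and these parts have degrees above h and k. *)
Lemma coarsening_nonzero_product h k : nonzero_product Del h k ->
  exists g g' : supp Gam,
    [/\ d g = h, d g' = k & nonzero_product Gam (val g) (val g')].
Proof.
move=> [a [b [ha kb /(@projection_mul_neq0 _ _ _ Gam _ _)[g [g' gg']]]]].
exists g, g'; split.
- apply: (projection_coarse_component ha) => g0.
  by apply: gg'; rewrite g0 linear0l.
- apply: (projection_coarse_component kb) => g0.
  by apply: gg'; rewrite g0 linear0r.
- exists (projection Gam (val g) a), (projection Gam (val g') b).
  by split=> //; exact: projection_component.
Qed.

End Coarsening.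

Section InducedCoarsening.
Local Open Scope ring_scope.
Variables (F : fieldType) (A : algebra F) (G H : groupType).
Variables (Gam : grading A G) (d : supp Gam -> H).
Hypothesis dM : degree_morphism d.

(** The sum of the components of Gam of degrees above h, described through
projections: in this form linear independence for distinct h needs no
regrouping of sums. *)
Definition coarse_component (h : H) : set A :=
  [set a | forall g : supp Gam, d g <> h -> projection Gam (val g) a = 0].

Lemma coarse_component_homogeneous (g : supp Gam) :
  Gam (val g) `<=` coarse_component (d g).
Proof.
move=> a ga h gh; rewrite (projection_homogeneous _ ga).
by case: eqP => // /val_inj hg; rewrite hg in gh.
Qed.

Fact coarse_submod h : submod_closed [in coarse_component h].
Proof.
split=> [|c a b /set_mem ah /set_mem bh]; apply/mem_set => g gh.
  by rewrite linear0.
by rewrite linearP /= (ah g gh) (bh g gh) scaler0 addr0.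
Qed.

Fact coarse_span (a : A) : exists s : seq H, exists f : H -> A,
  [/\ uniq s, forall h, coarse_component h (f h) & a = \sum_(h <- s) f h].
Proof.
have [s _ [_ aE]] := projection_sum Gam a.
(* Degrees outside the support may go anywhere: their components are zero. *)
pose e g : H := if insub g is Some x then d x else 1%g.
have eE (g : supp Gam) : e (val g) = d g by rewrite /e valK.
exists (undup (map e s)).
exists (fun h => \sum_(g <- s | e g == h) projection Gam g a); split.
- exact: undup_uniq.
- move=> h g gh; rewrite linear_sum; apply: big1 => k /eqP kh /=.
  rewrite (projection_homogeneous _ (projection_component Gam k a)).
  by case: eqP => // gk; rewrite -gk eE in kh.
rewrite (exchange_big_dep xpredT)//= [LHS]aE big_seq [RHS]big_seq.
apply: eq_bigr => g gs; rewrite -big_filter.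
rewrite (eq_filter (a2 := pred1 (e g))) => [|h]; last exact: eq_sym.
by rewrite filter_pred1_uniq ?undup_uniq ?mem_undup ?map_f// big_seq1.
Qed.

Fact coarse_free (s : seq H) (f : H -> A) : uniq s ->
  (forall h, coarse_component h (f h)) -> \sum_(h <- s) f h = 0 ->
  forall h, h \in s -> f h = 0.
Proof.
move=> us fE s0 h hs; apply: (@projection_eq0 _ _ _ Gam) => g.
have [gh|/eqP gh] := eqVneq (d g) h; last exact: fE.
move/(congr1 (projection Gam (val g))): s0; rewrite linear0 linear_sum.
rewrite (bigD1_seq h)//= big1 ?addr0// => k /eqP kh.
by apply: fE => gk; apply: kh; rewrite -gk -gh.
Qed.

Fact coarse_mul h k (a b : A) : coarse_component h a ->
  coarse_component k b -> coarse_component (h * k)%g (a ** b).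
Proof.
move=> ah bk l lhk.
have [s _ [_ aE]] := projection_sum Gam a.
have [t _ [_ bE]] := projection_sum Gam b.
rewrite aE bE linear_sumlz linear_sum; apply: big1 => g _ /=.
rewrite linear_sumr linear_sum; apply: big1 => g' _ /=.
set x := projection Gam g a; set y := projection Gam g' b.
have gx : Gam g x by exact: projection_component.
have gy : Gam g' y by exact: projection_component.
rewrite (projection_homogeneous _ (component_mul gx gy)).
case: eqP => // lE; apply: contrapT => xy0.
have x0 : x <> 0 by move=> x0; rewrite x0 linear0l in xy0.
have y0 : y <> 0 by move=> y0; rewrite y0 linear0r in xy0.
have gS := mem_set (mem_supp gx x0); have gS' := mem_set (mem_supp gy y0).
apply: lhk; rewrite (dM (g := SigSub gS) (h := SigSub gS'))//; last first.
  by exists x, y.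
congr (_ * _)%g; apply: contrapT.
  by move/(ah (SigSub gS)).
by move/(bk (SigSub gS')).
Qed.

Definition induced_coarsening : grading A H :=
  Grading coarse_submod coarse_span coarse_free coarse_mul.

End InducedCoarsening.

(** * Finiteness of coarsenings in terms of the universal group *)

(** A quotient of two degrees lies in the kernel of f exactly when f identifies
these degrees. *)
Lemma diff_kernelP (I : Type) (K H H' : groupType) (kappa : I -> K)
    (f : K -> H) (f' : K -> H') :
  {morph f : x y / (x * y)%g} -> {morph f' : x y / (x * y)%g} ->
  diff (range kappa) `&` kernel f = diff (range kappa) `&` kernel f' <->
  forall i j, f (kappa i) = f (kappa j) <-> f' (kappa i) = f' (kappa j).
Proof.
move=> fM f'M; split=> [ff' i j|ff'].
  have [->//|/eqP ij] := eqVneq (kappa i) (kappa j).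
  have W : diff (range kappa) (kappa i * (kappa j)^-1)%g.
    by exists (kappa i), (kappa j).
  rewrite -!kernel_div//; split=> kij.
    by have [] : (diff (range kappa) `&` kernel f') (kappa i * (kappa j)^-1)%g
      by rewrite -ff'.
  by have [] : (diff (range kappa) `&` kernel f) (kappa i * (kappa j)^-1)%g
    by rewrite ff'.
apply/seteqP; split=> _ [[u [v [[i _ <-] [j _ <-] ij ->]]]].
  move=> /(kernel_div fM)/ff' kij.
  by split; [exists (kappa i), (kappa j)|exact/kernel_div].
move=> /(kernel_div f'M)/ff' kij.
by split; [exists (kappa i), (kappa j)|exact/kernel_div].
Qed.

Section Criterion.
Variables (F : fieldType) (A : algebra F) (G : groupType) (Gam : grading A G).
Variables (U : groupType) (kappa : supp Gam -> U).
Hypothesis univ : is_universal_group kappa.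

(** A finite relabelling psi of Del, composed with the degree map of Del, is
multiplicative and so extends to U; its kernel is N, and N meets W as ker f
does because psi is injective. Conversely, when W meet N = W meet ker f, the
map U -> U / N restricted to degrees is constant on each class of merged
degrees and separates different classes, so it relabels Del by a finite
group. *)
Lemma coarsening_finiteP (H : groupType) (Del : grading A H) (f : U -> H) :
  {morph f : x y / (x * y)%g} ->
  (forall g, Gam (val g) `<=` Del (f (kappa g))) ->
  finite_group_weakly_equivalent Del <->
  exists N, [/\ normal_subgroup N, finite_index N &
    diff (range kappa) `&` N = diff (range kappa) `&` kernel f].
Proof.
move=> fM fDel.
have S (g : supp Gam) : f (kappa g) \in supp Del.
  exact/mem_set/(coarsening_supp fDel).
apply: (iff_trans (finite_group_weakly_equivalentP Del)).
split=> [[Q [psi [psi_inj psiM]]]|[N [normalN /(finite_index_kernel normalN)]]].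
  pose d (g : supp Gam) := psi (SigSub (S g)).
  have dM : degree_morphism d.
    move=> g h k [a [b [ga hb ab0]]] kE; apply: psiM.
      by exists a, b; split=> //=; exact: fDel.
    by rewrite /= (coarsening_degree_morphism fDel (g := g) (h := h))//;
       exists a, b.
  have [f' [f'M f'E]] := universal_lift univ dM.
  exists (kernel f'); split.
  - exact: kernel_normal.
  - exact: kernel_finite_index.
  apply/(diff_kernelP kappa f'M fM) => g h; rewrite !f'E /d; split.
    by move=> /psi_inj/(congr1 val).
  by move=> gh; congr psi; exact/val_inj.
move=> [Q [p [pM <-]]] /(diff_kernelP kappa pM fM) pf.
(* r picks a degree of Gam above each degree of Del; by pf the choice is
   immaterial after p. *)
have /choice[r rE] (h : supp Del) : exists g, f (kappa g) = val h.
  exact: (coarsening_supp_ex fDel (set_mem (valP h))).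
exists Q, (fun h => p (kappa (r h))); split=> [h k /pf|h k l].
  by rewrite !rE => /val_inj.
move=> /(coarsening_nonzero_product fDel)[g [g' [gh gk gg']]] lE.
have [a [b [ga g'b ab0]]] := gg'.
have S' := mem_set (mem_supp (component_mul ga g'b) ab0).
have kM := @universal_degree _ _ _ _ _ _ univ g g' (SigSub S') gg' erefl.
have -> : p (kappa (r h)) = p (kappa g) by apply/pf; rewrite rE gh.
have -> : p (kappa (r k)) = p (kappa g') by apply/pf; rewrite rE gk.
rewrite -pM -kM; apply/pf.
by rewrite rE lE kM fM gh gk.
Qed.

End Criterion.

Lemma normal_closure_normal (K : groupType) (X : set K) :
  normal_subgroup (normal_closure X).
Proof.
split=> [|x y Nx N nN XN]; last by have [_ +] := nN; apply; exact: Nx.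
split=> [|x y /set_mem Nx /set_mem Ny]; apply/mem_set => N nN XN.
  exact: normal_subgroup1.
by apply: normal_subgroup_div => //; [exact: Nx|exact: Ny].
Qed.

Lemma sub_normal_closure (K : groupType) (X : set K) : X `<=` normal_closure X.
Proof. by move=> x Xx N _; exact. Qed.

Theorem theorem4p10 (F : fieldType) (A : algebra F) (G : groupType)
    (Gam : grading A G) (U : groupType) (kappa : supp Gam -> U)
    (hU : is_universal_group kappa) :
  (finite_group_weakly_equivalent Gam <->
     residually_finite_wrt (diff (range kappa))) /\
  (finite_group_weakly_equivalent Gam /\
   (forall (H : groupType) (Del : grading A H), coarsening Gam Del ->
      finite_group_weakly_equivalent Del) <->
     hereditarily_residually_finite_wrt (diff (range kappa))).
Proof.
set W := diff _.
have part1 : finite_group_weakly_equivalent Gam <-> residually_finite_wrt W.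
  (* G itself gives the degree map that merges nothing. *)
  have [f [fM fE]] : exists f : U -> G,
      {morph f : x y / (x * y)%g} /\ forall g, f (kappa g) = val g.
    by apply: universal_lift => // g h k.
  have Wf : W `&` kernel f = set0.
    apply/seteqP; split=> // x [[_ [_ [[g _ <-] [h _ <-] gh ->]]]].
    move=> /(kernel_div fM); rewrite !fE => /val_inj gh'.
    by apply: gh; rewrite gh'.
  rewrite /residually_finite_wrt -Wf; apply: (coarsening_finiteP hU fM) => g.
  by rewrite fE.
split=> //; split=> [[_ finDel] X XW N1|hrf].
  have nN1 : normal_subgroup N1 by exact: normal_closure_normal.
  pose q := quotient_proj nN1.
  have qM : {morph q : x y / (x * y)%g} := quotient_projM nN1.
  have dM := degree_morphism_comp qM (universal_degree hU).
  have sub g := @coarse_component_homogeneous _ _ _ _ Gam (q \o kappa) g.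
  have [|N [nN finN WN]] :=
      (coarsening_finiteP hU (Del := induced_coarsening dM) qM sub).1 _.
    apply: finDel => g gS; exists (q (kappa (SigSub (mem_set gS)))).
    exact: (sub (SigSub (mem_set gS))).
  rewrite kernel_quotient_proj in WN.
  exists N; split=> // x; apply => // y Xy.
  have [] : (W `&` N) y => //; rewrite WN; split; first exact: XW.
  exact: sub_normal_closure.
split=> [|H Del coarse].
  (* The normal closure of the empty set is trivial, and 1 is not in W. *)
  apply/part1; have [N [nN finN _ WN]] := hrf set0 (@sub0set _ _).
  exists N; split=> //; rewrite WN.
  apply/seteqP; split=> // x [[u [v [_ _ uv ->]]]].
  have triv : normal_subgroup [set 1%g : U].
    split=> [|y z /= ->]; last by rewrite conj1g.
    split=> [|y z]; rewrite !inE//= => -> ->; by rewrite mulgV.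
  move=> /(_ _ triv (@sub0set _ _)) /= /(congr1 (mulg^~ v)).
  by rewrite mulgVK mul1g.
have /choice[d dDel] (g : supp Gam) : exists h, Gam (val g) `<=` Del h.
  exact/coarse/set_mem/(valP g).
have [f [fM fE]] := universal_lift hU (coarsening_degree_morphism dDel).
apply/(coarsening_finiteP hU fM) => [g|]; first by rewrite fE.
have [N [nN finN XN WN]] := hrf (W `&` kernel f) (@subIsetl _ _ _).
exists N; split=> //; rewrite WN; apply/seteqP; split=> x [Wx].
  by move=> /(_ _ (kernel_normal fM) (@subIsetr _ _ _)).
by move=> fx; split=> //; exact: sub_normal_closure.
Qed.
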